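(* Consider a finite absorbing Markov chain with state space $V$ and set of absorbing states $U\subseteq V$, and let $v\in V\setminus U$. Let $\mathbf{v}^{(N)}$ be the firing vector after $N$ steps of a hunger game process (with arbitrary initial hunger vector) on the rerouted Markov chain associated with $v$. Define $$b_N=\frac{N}{\sum_{u\in U}\mathbf{v}^{(N)}_u}-1,$$ with $b_N$ defined to be $0$ when the denominator equals $0$. Then $b_N$ converges to the expected absorption time $\mathbb{E}_vT_U$, and there exists a constant $C$ such that $|b_N-\mathbb{E}_vT_U|\le\frac{C}{N}$ for all $N\ge 1$.
   Context: A state $k$ is absorbing if $P_{kk}=1$. A Markov chain is absorbing if from each state there is a path of finite length (with positive transition probabilities) to an absorbing state. The absorption time is $T_U=\min\{t\ge 0: X_t\in U\}$, and $\mathbb{E}_v$ denotes expectation for the chain $X_0,X_1,\dots$ started at $X_0=v$. The rerouted Markov chain associated with $v$ is obtained from the original chain by replacing, for each $u\in U$, the row $P_u$ of the transition matrix by the unit vector $e_v$ (so every absorbing state now moves to $v$ with probability 1), and then deleting all states that cannot be reached from $v$ with positive probability. For a state $u$ that has been deleted, $\mathbf{v}^{(N)}_{u}$ is taken to be $0$. Hunger game process on a finite chain with transition matrix $P$ and totally ordered (indexed) states: let $H=P-I$ with rows $H_i$. At each step, let $i$ be the lowest-indexed state at which the hunger vector $\mathbf{h}$ attains its maximum, and replace $\mathbf{h}$ by $\mathbf{h}+H_i$; the chip is said to fire to $i$. The firing vector $\mathbf{v}^{(N)}$ after $N$ steps has $i$-th component equal to the number of those steps at which the chip fired to $i$. 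*)

(* Defs.v *)
From HB Require Import structures.
From mathcomp Require Import all_boot all_order all_algebra.
From mathcomp Require Import all_classical all_reals all_analysis.

Set Implicit Arguments.
Unset Strict Implicit.
Unset Printing Implicit Defensive.

Import Order.TTheory GRing.Theory Num.Theory.
Import numFieldNormedType.Exports.

Local Open Scope ring_scope.

Section FiniteChains.
Variables (R : realType) (S : finType).
Implicit Types P : S -> S -> R.

Definition stochastic P : Prop :=
  (forall x y, 0 <= P x y) /\ (forall x, \sum_y P x y = 1).

Definition pos_step P : rel S := fun x y => 0 < P x y.

Definition absorbing_states P : {set S} := [set k | P k k == 1]%SET.

Definition absorbing_chain P : Prop :=
  forall x, exists2 k, k \in absorbing_states P & connect (pos_step P) x k.

(* [idx] is the total ordering of the states used to break ties; [h n] is the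
   hunger vector after [n] steps, [h 0] being unconstrained, and [f n] is the
   state to which the chip fires at step [n.+1]. *)
Record hunger_game P (idx : S -> nat) (h : nat -> S -> R) (f : nat -> S) :
    Prop := HungerGame {
  fire_max : forall n i, h n i <= h n (f n);
  fire_lowest : forall n i, h n i = h n (f n) -> (idx (f n) <= idx i)%N;
  hunger_next : forall n i, h n.+1 i = h n i + (P (f n) i - (f n == i)%:R)
}.

Definition firing_vector (f : nat -> S) (N : nat) (i : S) : nat :=
  #|[set n : 'I_N | f n == i]%SET|.

End FiniteChains.

Section Rerouting.
Variables (R : realType) (V : finType) (P : V -> V -> R) (v : V).

Definition reroute_rows : V -> V -> R :=
  fun x y => if x \in absorbing_states P then (y == v)%:R else P x y.

(* Reachability is taken in the modified matrix. *)
Definition rerouted_state : finType :=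
  {x : V | connect (pos_step reroute_rows) v x}.

Definition rerouted_chain : rerouted_state -> rerouted_state -> R :=
  fun x y => reroute_rows (val x) (val y).

(* Firing vector indexed by all of [V], with value 0 at the deleted states. *)
Definition rerouted_firing (f : nat -> rerouted_state) (N : nat) (u : V) : nat :=
  if insub u is Some u' then firing_vector f N u' else 0%N.

Definition absorption_estimate (f : nat -> rerouted_state) (N : nat) : R :=
  let s := (\sum_(u in absorbing_states P) rerouted_firing f N u)%N in
  if s == 0%N then 0 else N%:R / s%:R - 1.

End Rerouting.

Section RandomChain.
Variables (R : realType) (V : finType).
Variables (d : measure_display) (Omega : measurableType d).
Local Open Scope classical_set_scope.
Local Open Scope ereal_scope.

(* The Markov property, in the product form that avoids conditioning on null
   events. *)
Record markov_chain (Pr : probability Omega R) (P : V -> V -> R) (v : V)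
    (X : nat -> Omega -> V) : Prop := MarkovChain {
  chain_measurable : forall t x, measurable (X t @^-1` [set x]);
  chain_start : Pr (X 0%N @^-1` [set v]) = 1;
  chain_step : forall (t : nat) (x : nat -> V),
    Pr [set w | forall s, (s <= t.+1)%N -> X s w = x s] =
    Pr [set w | forall s, (s <= t)%N -> X s w = x s] * (P (x t) (x t.+1))%:E
}.

Definition hitting_time (X : nat -> Omega -> V) (U : {set V}) (w : Omega) :
    \bar R :=
  if pselect (exists t, X t w \in U) is left hit
  then (ex_minn hit)%:R%:E else +oo.

Definition expected_absorption_time (Pr : probability Omega R)
    (P : V -> V -> R) (X : nat -> Omega -> V) : \bar R :=
  \int[Pr]_w hitting_time X (absorbing_states P) w.

End RandomChain.

(* Main.v *)
Require Import Defs.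
From HB Require Import structures.
From mathcomp Require Import all_boot all_order all_algebra.
From mathcomp Require Import all_classical all_reals all_analysis.
From mathcomp Require Import ring lra.

(* Let [g x] be the mean absorption time from [x]; it vanishes on [U] and
   satisfies [g = 1 + P g] off [U]. Firing at a state outside [U] changes the
   pairing of [g] with the hunger vector by [-1], and firing in [U] changes it
   by [g v]. After [N] steps, [s] of them in [U], the pairing has thus moved by
   [s (g v + 1) - N]. Hunger vectors stay bounded, so this quantity is bounded;
   hence [s] grows linearly in [N] and [N / s - 1] is within [O(1 / N)] of
   [g v]. *)

Set Implicit Arguments.
Unset Strict Implicit.
Unset Printing Implicit Defensive.

Import Order.TTheory GRing.Theory Num.Theory.
Import numFieldNormedType.Exports.

Local Open Scope classical_set_scope.
Local Open Scope ring_scope.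

(** * Boundedness of the hunger vector for a stochastic matrix *)

Section HungerGame.
Variables (R : realType) (S : finType) (P : S -> S -> R) (idx : S -> nat).
Variables (h : nat -> S -> R) (f : nat -> S).
Hypothesis P_stochastic : stochastic P.
Hypothesis game : hunger_game P idx h f.

(** A step adds row [f n] of [P - I] to the hunger, so the pairing with [g] moves by [P g - g] at
    [f n]; these increments telescope. *)
Lemma hunger_pairing (g : S -> R) N :
  \sum_i h N i * g i = \sum_i h 0%N i * g i +
    \sum_(n < N) (\sum_y P (f n) y * g y - g (f n)).
Proof.
elim: N => [|N IH]; first by rewrite big_ord0 addr0.
rewrite big_ord_recr /= addrA -IH.
under eq_bigr => i _ do rewrite (hunger_next game) mulrDl mulrBl.
rewrite big_split sumrB; congr (_ + (_ - _)).
rewrite (bigD1 (f N)) //= eqxx mul1r big1 ?addr0 // => i /negbTE.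
by rewrite eq_sym => ->; rewrite mul0r.
Qed.

Lemma hunger_sum N : \sum_i h N i = \sum_i h 0%N i.
Proof.
have := hunger_pairing (fun=> 1) N.
under eq_bigr do rewrite mulr1; under [in RHS]eq_bigr do rewrite mulr1.
move=> ->; rewrite [X in _ + X]big1 ?addr0 // => n _.
under eq_bigr do rewrite mulr1.
by rewrite P_stochastic.2 subrr.
Qed.

(* The total hunger is constant, so the fired state, being of maximal hunger,
   is at least at the average; firing is the only way to lose hunger. *)
Lemma hunger_lower_bound n i : - \sum_j `|h 0%N j| - 1 <= h n i.
Proof.
set B := \sum_j _.
have B_ge0 : 0 <= B by apply: sumr_ge0.
have fired_lb m : - B <= h m (f m).
  rewrite leNgt; apply/negP => hm.
  have : \sum_j h m j < - B.
    rewrite (bigD1 (f m)) //= -[- B]addr0 ltr_leD // sumr_le0 // => j _.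
    by rewrite (le_trans (fire_max game m j)) // (le_trans (ltW hm)) // oppr_le0.
  rewrite hunger_sum ltNge => /negP; apply.
  by rewrite lerNl -sumrN ler_sum // => j _; rewrite -normrN ler_norm.
elim: n i => [|n IH] i.
  have : `|h 0%N i| <= B by rewrite /B (bigD1 i) //= lerDl sumr_ge0.
  by rewrite ler_norml => /andP[? _]; lra.
rewrite (hunger_next game); have P0 := P_stochastic.1 (f n) i.
(* The fired state had hunger at least [- B] and loses at most 1, its diagonal entry being
   nonnegative; hence the bound [- B - 1]. *)
case: eqP => [<-|_] /=; last by have := IH i; lra.
by have := fired_lb n; have := P_stochastic.1 (f n) (f n); lra.
Qed.

(** Above, a coordinate is the constant total minus the others, each of which is at least
    [- B - 1]. *)
Lemma hunger_bounded : exists B, forall n i, `|h n i| <= B.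
Proof.
set B := \sum_j `|h 0%N j|.
have B_ge0 : 0 <= B by apply: sumr_ge0.
exists (B + #|S|%:R * (B + 1)) => n i.
have card_ge1 : 1 <= #|S|%:R :> R by rewrite ler1n; apply/card_gt0P; exists i.
have lb := hunger_lower_bound n; rewrite -/B in lb.
rewrite ler_norml; apply/andP; split; first by have := lb i; nra.
have sum_le : \sum_j h n j <= B.
  by rewrite hunger_sum ler_sum // => j _; rewrite ler_norm.
have : \sum_(j | j != i) h n j >= - (#|S|%:R * (B + 1)).
  apply: (@le_trans _ _ (\sum_(j | j != i) (- B - 1))); last exact: ler_sum.
  rewrite sumr_const -[leRHS]mulr_natl -mulrN opprD; apply: ler_wnM2r; first lra.
  by rewrite ler_nat max_card.
by move: sum_le; rewrite (bigD1 i) //=; lra.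
Qed.

(** The sum is the difference of the pairings at times [N] and 0, each bounded uniformly in time. *)
Lemma hunger_pairing_bounded (g : S -> R) : exists C, forall N,
  `|\sum_(n < N) (\sum_y P (f n) y * g y - g (f n))| <= C.
Proof.
have [B hB] := hunger_bounded.
have pair_le N : `|\sum_i h N i * g i| <= \sum_i B * `|g i|.
  apply: le_trans (ler_norm_sum _ _ _) _; apply: ler_sum => i _.
  by rewrite normrM ler_wpM2r.
exists (\sum_i B * `|g i| + \sum_i B * `|g i|) => N.
have -> : \sum_(n < N) (\sum_y P (f n) y * g y - g (f n)) =
    \sum_i h N i * g i - \sum_i h 0%N i * g i.
  by rewrite (hunger_pairing g N) addrC addKr.
by rewrite (le_trans (ler_normB _ _)) // lerD.
Qed.

End HungerGame.

(** * Rows and firing counts of the rerouted chain *)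

Section Rerouting.
Variables (R : realType) (V : finType) (P : V -> V -> R) (v : V).
Hypothesis P_stochastic : stochastic P.
Let U := absorbing_states P.

(** Deleting states loses no mass: a successor of positive probability of a reachable state is
    itself reachable. *)
Lemma rerouted_row_sum (x : rerouted_state P v) (g : V -> R) :
  \sum_y rerouted_chain x y * g (val y) =
  if val x \in U then g v else \sum_y P (val x) y * g y.
Proof.
rewrite -(big_sub (connect (pos_step (reroute_rows P v)) v)
           (fun y => reroute_rows P v (val x) y * g y)) /=.
transitivity (\sum_y reroute_rows P v (val x) y * g y).
  rewrite [RHS](bigID (connect (pos_step (reroute_rows P v)) v)) /=.
  rewrite [X in _ + X]big1 ?addr0 // => y.
  apply: contraNeq => /eqP nz; apply: connect_trans (valP x) (connect1 _).
  rewrite /pos_step lt_def; apply/andP; split.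
    by apply/eqP => z; apply: nz; rewrite z mul0r.
  by rewrite /reroute_rows; case: ifP => _; rewrite ?ler0n ?P_stochastic.1.
rewrite /reroute_rows -/U; case: ifP => // _.
rewrite (bigD1 v) //= eqxx mul1r big1 ?addr0 // => y /negbTE ->.
by rewrite mul0r.
Qed.

Lemma rerouted_stochastic : stochastic (@rerouted_chain R V P v).
Proof.
split=> [x y|x].
  by rewrite /rerouted_chain /reroute_rows; case: ifP => _;
     rewrite ?ler0n ?P_stochastic.1.
have := rerouted_row_sum x (fun=> 1).
under eq_bigr do rewrite mulr1; move=> ->; case: ifP => // _.
by under eq_bigr do rewrite mulr1; rewrite P_stochastic.2.
Qed.

(** Double counting of the firings in [U], by state and by step; a deleted state never fires, in
    accordance with its default count 0. *)
Lemma rerouted_firing_absorbing (f : nat -> rerouted_state P v) N :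
  (\sum_(u in U) rerouted_firing f N u = \sum_(n < N) (val (f n) \in U))%N.
Proof.
have firingE u : rerouted_firing f N u = (\sum_(n < N) (val (f n) == u))%N.
  rewrite /rerouted_firing; case: insubP => [u' _ <-|unreach].
    rewrite /firing_vector -sum1dep_card big_mkcond /=.
    by apply: eq_bigr => n _; rewrite (inj_eq val_inj); case: eqP.
  rewrite big1 // => n _; apply/eqP; rewrite eqb0.
  by apply: contraNneq unreach => <-; exact: valP.
under eq_bigr do rewrite firingE.
rewrite exchange_big /=; apply: eq_bigr => n _.
have [fU|fU] := boolP (val (f n) \in U).
  rewrite (bigD1 (val (f n))) //= eqxx big1 ?addn0 // => u /andP[_ /negbTE].
  by rewrite eq_sym => ->.
by rewrite big1 // => u uU; apply/eqP; rewrite eqb0; apply: contraNneq fU => /= ->.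
Qed.

End Rerouting.

(** * The error bound, for any solution [g] of the absorption-time equations *)

Section AbsorptionEstimate.
Variables (R : realType) (V : finType) (P : V -> V -> R) (v : V).
Variables (idx : rerouted_state P v -> nat).
Variables (h : nat -> rerouted_state P v -> R) (f : nat -> rerouted_state P v).
Variable g : V -> R.
Hypothesis P_stochastic : stochastic P.
Hypothesis game : hunger_game (@rerouted_chain R V P v) idx h f.
Hypothesis g_absorbing : forall x, x \in absorbing_states P -> g x = 0.
Hypothesis g_transient :
  forall x, x \notin absorbing_states P -> g x = 1 + \sum_y P x y * g y.
Hypothesis g_ge0 : 0 <= g v.

(** Dividing the bounded quantity [s (g v + 1) - N] by [s] gives an error of at most [C / s]; the
    linear growth of [s] turns this into a multiple of [1 / N]. *)
Lemma absorption_estimate_bound : exists C, forall N, (1 <= N)%N ->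
  `|absorption_estimate f N - g v| <= C / N%:R.
Proof.
have [C hC] := hunger_pairing_bounded (rerouted_stochastic v P_stochastic) game
  (fun x => g (val x)).
exists (C * (C + 1 + g v)) => N N1.
have NR : 1 <= N%:R :> R by rewrite ler1n.
have NR0 : 0 < N%:R :> R by rewrite ltr0n.
rewrite /absorption_estimate rerouted_firing_absorbing.
set s := (\sum_(n < N) _)%N.
have {hC} := hC N.
have -> : \sum_(n < N) (\sum_y rerouted_chain (f n) y * g (val y) - g (val (f n)))
    = s%:R * (g v + 1) - N%:R.
  have -> : N%:R = \sum_(n < N) 1 :> R by rewrite sumr_const card_ord.
  rewrite natr_sum mulr_suml -sumrB; apply: eq_bigr => n _.
  rewrite rerouted_row_sum //=; case: ifPn => fU.
    by rewrite (g_absorbing fU) mul1r addrK subr0.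
  by rewrite (g_transient fU) mul0r; ring.
move=> hC; have C0 : 0 <= C by apply: le_trans hC.
(* If [s = 0], the estimate is 0 by convention and the bound reads [N <= C], so the error [g v] is
   at most [C * g v / N]. *)
case: eqP => [s0|/eqP s0].
  move: hC; rewrite s0 mul0r sub0r normrN ger0_norm // => hC.
  rewrite sub0r normrN ger0_norm // ler_pdivlMr //.
  have := ler_wpM2l g_ge0 hC; have : 0 <= C * (C + 1) by apply: mulr_ge0; lra.
  lra.
have s1 : 1 <= s%:R :> R by rewrite ler1n lt0n.
have sR0 : 0 < s%:R :> R by lra.
have -> : N%:R / s%:R - 1 - g v = - (s%:R * (g v + 1) - N%:R) / s%:R.
  by field; lra.
rewrite normrM normrN normfV (ger0_norm (ltW sR0)) ler_pdivlMr //.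
(* From [N <= s (g v + 1) + C], where [C <= s C] because [s >= 1]. *)
have N_le : N%:R <= s%:R * (C + 1 + g v).
  by move: hC; rewrite ler_norml => /andP[? _]; nra.
rewrite mulrAC ler_pdivrMr //.
apply: (@le_trans _ _ (C * N%:R)); first by rewrite ler_pM2r.
by rewrite -mulrA ler_wpM2l // mulrC.
Qed.

End AbsorptionEstimate.

(** * Survival probabilities and the mean absorption time *)

Section Survival.
Variables (R : realType) (V : finType) (P : V -> V -> R).
Hypothesis P_stochastic : stochastic P.
Let U := absorbing_states P.

(* The probability that the chain started at [x] is not absorbed by time [k]. *)
Fixpoint survival (k : nat) (x : V) : R :=
  if x \in U then 0
  else if k is k'.+1 then \sum_y P x y * survival k' y else 1.

Lemma survival_absorbing k x : x \in U -> survival k x = 0.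
Proof. by case: k => [|k] /= ->. Qed.

Lemma survival0 x : x \notin U -> survival 0 x = 1.
Proof. by move=> /= /negbTE ->. Qed.

Lemma survivalS k x : x \notin U ->
  survival k.+1 x = \sum_y P x y * survival k y.
Proof. by move=> /= /negbTE ->. Qed.

Lemma survival_ge0 k x : 0 <= survival k x.
Proof.
elim: k x => [|k IH] x /=; case: ifP => // _.
by apply: sumr_ge0 => y _; rewrite mulr_ge0 // P_stochastic.1.
Qed.

Lemma survival_le1 k x : survival k x <= 1.
Proof.
elim: k x => [|k IH] x /=; case: ifP => // _.
rewrite -[leRHS](P_stochastic.2 x); apply: ler_sum => y _.
by rewrite ler_piMr // P_stochastic.1.
Qed.

Lemma survival_decr k x : survival k.+1 x <= survival k x.
Proof.
elim: k x => [|k IH] x; have [xU|xU] := boolP (x \in U).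
- by rewrite !survival_absorbing.
- by rewrite survival0 // survival_le1.
- by rewrite !survival_absorbing.
rewrite !(survivalS _ xU); apply: ler_sum => y _.
by rewrite ler_wpM2l // P_stochastic.1.
Qed.

Lemma survival_le m n x : (m <= n)%N -> survival n x <= survival m x.
Proof.
move=> /subnK <-; elim: (n - m)%N => [|k IH] //.
exact: le_trans (survival_decr _ _) IH.
Qed.

(** Induction along the path: a successor of positive probability whose survival is below 1 pulls
    the average strictly below 1. *)
Lemma survival_path_lt1 x p :
  path (pos_step P) x p -> last x p \in U -> survival (size p) x < 1.
Proof.
elim: p x => [|y p IH] x /=; first by move=> _ ->.
case/andP=> Pxy /IH/[apply] lt1; case: ifP => // _.
rewrite -[ltRHS](P_stochastic.2 x) (bigD1 y) //= [ltRHS](bigD1 y) //=.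
apply: ltr_leD; first by rewrite gtr_pMr.
by apply: ler_sum => z _; rewrite ler_piMr ?P_stochastic.1 ?survival_le1.
Qed.

Hypothesis P_absorbing : absorbing_chain P.

(** Survival decreases in time, so the largest of the finitely many times at which it drops below 1
    serves all states. *)
Lemma survival_uniform : exists T : nat, exists2 q : R, 0 <= q < 1 &
  (0 < T)%N /\ forall x, survival T x <= q.
Proof.
have /choice[t ht] x : exists k, survival k x < 1.
  have [u uU /connectP[p xp pu]] := P_absorbing x.
  by exists (size p); rewrite survival_path_lt1 // -pu.
(* The successor makes [T] positive, so that subtracting [T] later decreases an index. *)
pose T := (\max_x t x).+1.
exists T, (\big[Num.max/0]_x survival T x); last first.
  by split=> // x; exact: le_bigmax.
apply/andP; split; first exact: bigmax_ge_id.
apply: bigmax_lt => // x _; apply: le_lt_trans (ht x).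
by rewrite survival_le // leqW // leq_bigmax.
Qed.

(** First-step analysis; in the limit it becomes [g = 1 + P g]. *)
Lemma sum_survivalS n x : x \notin U ->
  \sum_(k < n.+1) survival k x = 1 + \sum_y P x y * \sum_(k < n) survival k y.
Proof.
move=> xU; rewrite big_ord_recl survival0 //; congr (_ + _).
under eq_bigr do rewrite survivalS //.
by rewrite exchange_big; apply: eq_bigr => y _; rewrite mulr_sumr.
Qed.

(** The Markov property at time [m]: the chain is still unabsorbed with probability [survival m x],
    and from wherever it is the next [n] terms add up to at most [K]. *)
Lemma sum_survival_shift K n m x :
  (forall y, \sum_(k < n) survival k y <= K) ->
  \sum_(k < n) survival (m + k) x <= K * survival m x.
Proof.
move=> hK; elim: m x => [|m IH] x; have [xU|xU] := boolP (x \in U).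
- by rewrite big1 ?survival_absorbing ?mulr0 // => k _; rewrite survival_absorbing.
- by rewrite survival0 // mulr1.
- by rewrite big1 ?survival_absorbing ?mulr0 // => k _; rewrite survival_absorbing.
under eq_bigr do rewrite addSn survivalS //.
rewrite exchange_big survivalS // mulr_sumr; apply: ler_sum => y _.
by rewrite -mulr_sumr mulrCA ler_wpM2l // P_stochastic.1.
Qed.

(* After [T] steps at most a fraction [q < 1] of the mass survives, so the
   supremum [K] of the partial sums satisfies [K <= T + q K]. *)
Lemma sum_survival_bounded :
  exists K, forall n x, \sum_(k < n) survival k x <= K.
Proof.
have [T [q /andP[q0 q1] [T0 hq]]] := survival_uniform.
have sum_le n x : \sum_(k < n) survival k x <= n%:R.
  rewrite -[n in leRHS]card_ord -sumr_const.
  by apply: ler_sum => k _; exact: survival_le1.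
have q1' : 0 < 1 - q by rewrite subr_gt0.
(* [K] solves [K = T + q K]; strong induction on [n] shows that it bounds the partial sums. *)
pose K := T%:R / (1 - q); have K0 : 0 <= K by rewrite divr_ge0 // ltW.
exists K => n; have [m] := ubnP n; elim: m n => // m IH n nm x.
have [nT|Tn] := leqP n T.
  apply: le_trans (sum_le _ _) _; rewrite ler_pdivlMr //.
  have : n%:R <= T%:R :> R by rewrite ler_nat.
  by have := ler0n R n; nra.
rewrite -(subnKC (ltnW Tn)) big_split_ord /=.
apply: (@le_trans _ _ (T%:R + K * q)).
  apply: lerD; first exact: sum_le.
  apply: le_trans (sum_survival_shift (K := K) _ _ _) _; last exact: ler_wpM2l.
  move=> y; apply: IH; rewrite (leq_trans _ (nm : (n <= m)%N)) //.
  by rewrite ltn_subrL T0 (ltn_trans T0).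
by rewrite /K le_eqVlt; apply/orP; left; apply/eqP; field; lra.
Qed.

(** The mean is built as the sum of the tail probabilities, whose partial sums are monotone and
    bounded. *)
Lemma mean_absorption_time : exists g : V -> R,
  [/\ forall x, \sum_(k < n) survival k x @[n --> \oo] --> g x,
      forall x, 0 <= g x,
      forall x, x \in U -> g x = 0
    & forall x, x \notin U -> g x = 1 + \sum_y P x y * g y].
Proof.
have [K hK] := sum_survival_bounded.
pose G x n := \sum_(k < n) survival k x.
have G_homo x : {homo G x : m n / (m <= n)%N >-> m <= n}.
  apply: homo_leq => [//||n]; first exact: le_trans.
  by rewrite /G big_ord_recr /= lerDl survival_ge0.
have G_cvg x : cvgn (G x).
  by apply: nondecreasing_is_cvgn => //; exists K => _ [n _ <-]; exact: hK.
exists (fun x => limn (G x)); split=> [x|x|x xU|x xU].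
- exact: G_cvg.
- by have := nondecreasing_cvgn_le (G_homo x) (G_cvg x) 0; rewrite /G big_ord0.
- apply: (@cvg_lim R) => //; rewrite (_ : G x = fun=> 0); first exact: cvg_cst.
  by apply/funext => n; apply: big1 => k _; rewrite survival_absorbing.
apply: (@cvg_lim R) => //; rewrite -(cvg_shiftS (G x)).
rewrite (_ : [sequence G x n.+1]_n = fun n => 1 + \sum_y P x y * G y n); last first.
  by apply/funext => n; exact: sum_survivalS.
apply: cvgD; first exact: cvg_cst.
apply: cvg_big => [|y _]; first exact: add_continuous.
by apply: cvgM; [exact: cvg_cst|exact: G_cvg].
Qed.

End Survival.

(** * The integral of the hitting time as a sum of survival probabilities *)

Section AbsorptionTime.
Variables (R : realType) (V : finType) (P : V -> V -> R) (v : V).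
Variables (d : measure_display) (Omega : measurableType d).
Variables (Pr : probability Omega R) (X : nat -> Omega -> V).
Hypothesis P_stochastic : stochastic P.
Hypothesis X_chain : markov_chain Pr P v X.
Let U := absorbing_states P.

Let cylinder t (x : nat -> V) : set Omega :=
  [set w | forall s, (s <= t)%N -> X s w = x s].
Let transient t k : set Omega :=
  [set w | forall s, (t <= s <= t + k)%N -> X s w \notin U].

Lemma measurable_state t (D : pred V) : measurable [set w | D (X t w)].
Proof.
rewrite (_ : [set w | _] = \bigcup_(x in [set x | D x]) (X t @^-1` [set x])).
  apply: fin_bigcup_measurable; first exact: finite_finset.
  by move=> x _; exact: chain_measurable X_chain t x.
by apply/seteqP; split=> [w Dw|w [x Dx /= ->]] //; exists (X t w).
Qed.

Lemma measurable_cylinder t x : measurable (cylinder t x).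
Proof.
rewrite (_ : cylinder t x =
    \bigcap_(s in [set s | (s <= t)%N]) [set w | X s w == x s]).
  apply: bigcap_measurableType => s _.
  exact: measurable_state (fun y => y == x s).
by apply/seteqP; split=> w h s st /=; apply/eqP; exact: h.
Qed.

Lemma measurable_transient t k : measurable (transient t k).
Proof.
rewrite (_ : transient t k =
    \bigcap_(s in [set s | (t <= s <= t + k)%N]) [set w | X s w \notin U]) //.
apply: bigcap_measurableType => s _.
exact: measurable_state (fun y => y \notin U).
Qed.

Lemma cylinder_transient_absorbed t x k :
  x t \in U -> cylinder t x `&` transient t k = set0.
Proof.
move=> xU; apply/seteqP; split=> // w [wx /(_ t)].
by rewrite leqnn leq_addr wx // xU => /(_ isT).
Qed.

(** Induction on [k], splitting by the state at time [t.+1]; the product form needs no conditioning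
    on possibly null prefixes. *)
Lemma prob_cylinder_transient k t x :
  Pr (cylinder t x `&` transient t k) =
  (Pr (cylinder t x) * (survival P k (x t))%:E)%E.
Proof.
elim: k t x => [|k IH] t x; have [xU|xU] := boolP (x t \in U).
- by rewrite cylinder_transient_absorbed // measure0 survival_absorbing // mule0.
- rewrite survival0 // mule1 setIidl // => w wx s.
  by rewrite addn0 -eqn_leq => /eqP <-; rewrite wx.
- by rewrite cylinder_transient_absorbed // measure0 survival_absorbing // mule0.
(* [upd y] prolongs the prefix [x] by [y]; the events [F y] partition the event in question. *)
pose upd y s := if s == t.+1 then y else x s.
have updx y s : (s <= t)%N -> upd y s = x s.
  by move=> st; rewrite /upd ltn_eqF.
have upd_cyl y : cylinder t (upd y) = cylinder t x.
  by apply/seteqP; split=> w wx s st; rewrite wx ?updx.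
pose F y := cylinder t.+1 (upd y) `&` transient t.+1 k.
have -> : cylinder t x `&` transient t k.+1 =
    \bigcup_(y in [set` index_enum V]) F y.
  apply/seteqP; split=> [w [wx wU]|w [y _ [wy wU]]].
    exists (X t.+1 w) => /=; first exact: mem_index_enum.
    split=> s; last by rewrite addSnnS => /andP[ts sk]; rewrite wU // sk ltnW.
    rewrite leq_eqVlt => /orP[/eqP->|st]; first by rewrite /upd eqxx.
    by rewrite updx // wx.
  have wx : cylinder t x w by move=> s st; rewrite wy ?updx // leqW.
  split=> // s /andP[]; rewrite leq_eqVlt => /orP[/eqP<- _|ts sk].
    by rewrite wx.
  by apply: wU; rewrite ts addSnnS.
rewrite measure_fin_bigcup; first last.
- by move=> y _; apply: measurableI;
    [exact: measurable_cylinder|exact: measurable_transient].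
- move=> y z _ _ [w [[wy _] [wz _]]].
  by have := wz t.+1 (leqnn _); rewrite wy // /upd eqxx.
- exact: finite_seq.
rewrite -fsbig_seq ?index_enum_uniq // survivalS //.
have cyl_fin : Pr (cylinder t x) \is a fin_num.
  by apply: fin_num_measure; exact: measurable_cylinder.
rewrite -sumEFin -(fineK cyl_fin) ge0_sume_distrr; last first.
  by move=> y _; rewrite lee_fin mulr_ge0 ?P_stochastic.1 ?survival_ge0.
apply: eq_bigr => y _; apply: etrans (IH _ _) _.
rewrite [Pr (cylinder _ _)](chain_step X_chain).
by rewrite -/(cylinder t (upd y)) upd_cyl updx // /upd eqxx fineK // EFinM muleA.
Qed.

(** The chain starts at [v] only almost surely, so the part of the event off the cylinder at [v] is
    first discarded as null. *)
Lemma prob_transient k : Pr (transient 0 k) = (survival P k v)%:E.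
Proof.
have cyl0 : cylinder 0 (fun=> v) = X 0%N @^-1` [set v].
  apply/seteqP; split=> [w /(_ 0%N (leqnn _))|w wv s] //.
  by rewrite leqn0 => /eqP->.
have cyl1 : Pr (cylinder 0 (fun=> v)) = 1%E.
  by rewrite cyl0; exact: chain_start X_chain.
have mC := measurable_cylinder 0 (fun=> v); have mT := measurable_transient 0 k.
have mTD : measurable (transient 0 k `\` cylinder 0 (fun=> v)) by exact: measurableD.
have TD0 : Pr (transient 0 k `\` cylinder 0 (fun=> v)) = 0%E.
  apply: (@subset_measure0 _ _ _ _ _ (~` cylinder 0 (fun=> v))) => //.
  - exact: measurableC.
  - by apply: etrans (probability_setC Pr mC) _; rewrite cyl1 subee.
rewrite -(setUIDK (transient 0 k) (cylinder 0 (fun=> v))).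
rewrite measureU0 //; last exact: measurableI.
rewrite setIC; apply: etrans (prob_cylinder_transient _ _ _) _.
by rewrite cyl1 mul1e.
Qed.

(* [hitting_time X U w] counts the times [n] with [X s w \notin U] for all
   [s <= n], so its mean is the sum of the tail probabilities. *)
Lemma hitting_timeE w :
  hitting_time R X U w = (\sum_(n <oo) (\1_(transient 0 n) w)%:E)%E.
Proof.
rewrite /hitting_time; case: pselect => [hit|nhit].
  case: ex_minnP => m mU m_min; symmetry.
  have ind n : \1_(transient 0 n) w = (n < m)%N%:R :> R.
    rewrite indicE; congr (_%:R); congr nat_of_bool; apply/idP/idP.
      by rewrite inE => nU; rewrite ltnNge; apply/negP => mn;
         have := nU m mn; rewrite mU.
    move=> nm; rewrite inE => s /= sn; apply/negP => sU.
    by have := leq_trans nm (m_min _ sU); rewrite ltnNge sn.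
  apply: (@cvg_lim (\bar R)) => //; apply: cvg_near_cst.
  exists m => // n /= mn.
  rewrite sumEFin; congr (_%:E); under eq_bigr do rewrite ind.
  rewrite -natr_sum; congr (_%:R).
  rewrite (big_cat_nat _ mn) //= [X in (_ + X)%N]big1_seq ?addn0; last first.
    by move=> i; rewrite mem_index_iota /= => /andP[mi _]; rewrite ltnNge mi.
  rewrite (eq_big_nat _ _ (F2 := fun=> 1%N)); last by move=> i /andP[_ ->].
  by rewrite sum_nat_const_nat subn0 muln1.
(* Without absorption every indicator is 1 and the series diverges to the default value [+oo]. *)
symmetry; rewrite (_ : (fun n => _) = fun n => (n%:R)%:E); last first.
  apply/funext => n; rewrite sumEFin; congr _%:E.
  rewrite (eq_bigr (fun=> 1)); first by rewrite sumr_const_nat subn0.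
  move=> i _; rewrite indicE mem_set // => s _ /=.
  by apply/negP => sU; apply: nhit; exists s.
by apply: (@cvg_lim (\bar R)) => //; apply/cvgenyP.
Qed.

(** The terms are nonnegative, so integral and series may be exchanged. *)
Lemma expected_absorption_timeE (m : R) :
  \sum_(k < n) survival P k v @[n --> \oo] --> m ->
  expected_absorption_time Pr P X = m%:E.
Proof.
move=> sum_cvg; rewrite /expected_absorption_time.
have -> : hitting_time R X (absorbing_states P) = _ := funext hitting_timeE.
have mT n : measurable (transient 0 n) by exact: measurable_transient.
rewrite integral_nneseries //.
  have partial_sum n : (\sum_(0 <= k < n) \int[Pr]_w (\1_(transient 0 k) w)%:E =
      (\sum_(k < n) survival P k v)%:E)%E.
    rewrite -sumEFin big_mkord; apply: eq_bigr => k _.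
    by rewrite integral_indic // setIT; exact: prob_transient.
  rewrite (funext partial_sum).
  apply: (@cvg_lim (\bar R)) => //.
  by apply: cvg_EFin; [exact: nearW|exact: sum_cvg].
move=> n; apply/measurable_realfun.measurable_EFinP.
exact: measurable_realfun.measurable_indic.
Qed.

End AbsorptionTime.

(** * Identification of [g v] with the expected absorption time, and convergence from the rate *)

Theorem theorem6p5 (R : realType) (V : finType) (P : V -> V -> R) (v : V)
    (d : measure_display) (Omega : measurableType d) (Pr : probability Omega R)
    (X : nat -> Omega -> V)
    (idx : rerouted_state P v -> nat)
    (h : nat -> rerouted_state P v -> R) (f : nat -> rerouted_state P v)
    (P_stochastic : stochastic P)
    (P_absorbing : absorbing_chain P)
    (v_notin_U : v \notin absorbing_states P)
    (X_chain : markov_chain Pr P v X)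
    (idx_inj : injective idx)
    (hf_game : hunger_game (@rerouted_chain R V P v) idx h f) :
  ((absorption_estimate f N)%:E @[N --> \oo]
     --> expected_absorption_time Pr P X) /\
  exists C : R, forall N : nat, (1 <= N)%N ->
    (`| (absorption_estimate f N)%:E - expected_absorption_time Pr P X |
       <= (C / N%:R)%:E)%E.
Proof.
have [g [g_cvg g_ge0 g_abs g_trans]] :=
  mean_absorption_time P_stochastic P_absorbing.
rewrite (expected_absorption_timeE P_stochastic X_chain (g_cvg v)).
have [C hC] :=
  absorption_estimate_bound P_stochastic hf_game g_abs g_trans (g_ge0 v).
split; last first.
  by exists C => N N1; rewrite -EFinB abse_EFin lee_fin hC.
apply: cvg_EFin; first exact: nearW.
have C_cvg : C / n%:R @[n --> \oo] --> (0 : R).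
  (* The shift is needed because [harmonic n] is [1 / (n + 1)]. *)
  rewrite -(cvg_shiftS (fun n => C / n%:R)).
  have : C * harmonic n @[n --> \oo] --> C * (0 : R).
    by apply: cvgM; [exact: cvg_cst|exact: cvg_harmonic].
  by rewrite mulr0.
apply/cvgrPdist_le => e e0; near=> N; rewrite /=.
rewrite distrC (le_trans (hC N _)) //; first by near: N; exact: nbhs_infty_ge.
rewrite (le_trans (ler_norm _)) // -normrN -[- _]sub0r.
by near: N; exact: (cvgr_dist_le _ _ C_cvg _ e0).
Unshelve. all: by end_near.
Qed.
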